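(* Let $g:\mathbb{C}^2\to\mathbb{C}^2$, $g(x,y)=(x-y^2+ax^{r+1},\,y-xy)$, where either (1) $a\in\mathbb{C}\setminus\{0\}$ and $r\in\mathbb{N}$ with $r\geq3$; or (2) $a\in\mathbb{C}\setminus\mathbb{R}_{\geq0}$ and $r=2$. Then $g$ has a domain of attraction to the origin along $[1:0]$.
   Context: For a holomorphic self-map $F$ of $\mathbb{C}^2$ fixing the origin $O$ and tangent to the identity there ($\mathrm{d}F(O)=\mathrm{Id}$, $F\not\equiv\mathrm{Id}$), and $[v]\in\mathbb{P}^1(\mathbb{C})$, a domain of attraction to the origin along $[v]$ is a (non-empty, open, connected) domain $\Omega\subset\mathbb{C}^2$ with the origin in its boundary such that $F(\Omega)\subset\Omega$ and, for every $z\in\Omega$, $F^n(z)\to O$ and $[F^n(z)]\to[v]$ in $\mathbb{P}^1(\mathbb{C})$ as $n\to\infty$, where $F^n$ denotes the $n$-th iterate. *)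

(* Defs.v *)
From HB Require Import structures.
From mathcomp Require Import all_boot all_order all_algebra.
From mathcomp Require Import generic_quotient.
From mathcomp Require Import all_classical all_reals all_analysis.
From mathcomp Require Import complex.

Set Implicit Arguments.
Unset Strict Implicit.
Unset Printing Implicit Defensive.

Import Order.TTheory GRing.Theory Num.Theory numFieldNormedType.Exports.

Local Open Scope classical_set_scope.
Local Open Scope ring_scope.
Local Open Scope complex_scope.
Local Open Scope quotient_scope.

(* R[i] is a numFieldType, but its normed topology is not found by unification
   on the carrier [complex R] unless it is copied from the regular module. *)
HB.instance Definition _ (R : realType) := NormedModule.copy R[i] (R[i]^o).

Notation C2 R := (R[i] * R[i])%type.

Section ProjectiveLine.
Variable R : realType.

(* As a [set_type], this carries the subspace topology. *)
Definition C2star : Type := ([set~ 0] : set (C2 R)).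
HB.instance Definition _ := Topological.on C2star.
HB.instance Definition _ := Choice.on C2star.

Definition same_line (u v : C2star) : bool :=
  `[< exists t : R[i], t != 0 /\ set_val u = t *: set_val v >].

Lemma same_line_refl : reflexive same_line.
Proof. by move=> u; apply/asboolP; exists 1; rewrite oner_neq0 scale1r. Qed.

Lemma same_line_sym : symmetric same_line.
Proof.
suff H u v : same_line u v -> same_line v u by move=> u v; apply/idP/idP; exact: H.
move=> /asboolP[t [t0 uv]]; apply/asboolP; exists t^-1.
by rewrite invr_neq0// uv scalerA mulVf// scale1r.
Qed.

Lemma same_line_trans : transitive same_line.
Proof.
move=> v u w /asboolP[s [s0 uv]] /asboolP[t [t0 vw]]; apply/asboolP.
by exists (s * t); rewrite mulf_neq0// uv vw scalerA.
Qed.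

Canonical same_line_equiv :=
  EquivRel same_line same_line_refl same_line_sym same_line_trans.

Definition P1 : Type := quotient_topology {eq_quot same_line}.
HB.instance Definition _ := Topological.on P1.
HB.instance Definition _ := Quotient.on P1.

Definition P1_class (z : C2 R) (z_neq0 : z <> 0) : P1 :=
  \pi_P1 (exist _ z (mem_set z_neq0) : C2star).

Lemma e1_neq0 : (1, 0) <> 0 :> C2 R.
Proof. by move=> [] /eqP; rewrite oner_eq0. Qed.

(* the point [1 : 0] *)
Definition P1_e1 : P1 := P1_class e1_neq0.

End ProjectiveLine.

Definition boundary (T : topologicalType) (A : set T) : set T :=
  closure A `\` interior A.

(* In the last clause, [z_n] only makes sense for z_n <> 0; for an open
   F-invariant Omega whose boundary contains 0 the orbit condition orb_neq0
   is automatic. *)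
Definition domain_of_attraction (R : realType) (F : C2 R -> C2 R) (v : P1 R)
    (Omega : set (C2 R)) : Prop :=
  [/\ Omega !=set0, open Omega & connected Omega] /\
  boundary Omega 0 /\
  F @` Omega `<=` Omega /\
  forall z, Omega z ->
    iter n F z @[n --> \oo] --> (0 : C2 R) /\
    exists orb_neq0 : forall n, iter n F z <> 0,
      P1_class (orb_neq0 n) @[n --> \oo] --> v.

(* Main.v *)
Require Import Defs.
From mathcomp Require Import all_boot all_order all_algebra.
From mathcomp Require Import all_classical all_reals all_analysis.
From mathcomp Require Import complex ring lra.
Import Order.TTheory GRing.Theory Num.Theory numFieldNormedType.Exports.
Local Open Scope classical_set_scope.
Local Open Scope ring_scope.
Local Open Scope complex_scope.

(** Choose zeta with [a * zeta ^+ r = -1] and [Re zeta > 0]; this is where the hypotheses enter: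
    the r-th roots of [- a^-1] are spaced by an angle [2 pi / r], so one of them lies in the open
    right half-plane if [r >= 3], and also if [r = 2] unless both are purely imaginary, i.e.
    unless [a > 0]. With [x = zeta * w] and [n = r + 1] the map reads
    [w |-> w - w ^+ n - y ^+ 2 / zeta] and [y |-> (1 - x) * y]. On a thin triangular sector around
    the positive w-axis the first map is a parabolic contraction, up to the error [y ^+ 2 / zeta].
    There [Re x >= c * `|x|] with [c > 0], so [y] shrinks by a factor [1 - c' * Re w], whereas
    [(Re w) ^+ n] shrinks only by a factor [1 - O((Re w) ^+ 2)]. Hence the cusp [`|y| < (Re w) ^+ n]
    over the sector is invariant, and the error is negligible there. *)

(** * Coordinates and squared modulus of complex numbers *)

Local Notation Re := (@complex.Re _).
Local Notation Im := (@complex.Im _).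

(** The norm on [R[i]] takes values in [R[i]]; this squared modulus lies in [R] and is polynomial in
    the coordinates, so estimates stay within real ordered-field arithmetic. *)
Definition sqnormc {R : rcfType} (z : R[i]) : R := Re z ^+ 2 + Im z ^+ 2.

Lemma Re_mulc {R : rcfType} (x y : R[i]) : Re (x * y) = Re x * Re y - Im x * Im y.
Proof. by case: x => ? ?; case: y. Qed.

Lemma Im_mulc {R : rcfType} (x y : R[i]) : Im (x * y) = Re x * Im y + Im x * Re y.
Proof. by case: x => ? ?; case: y. Qed.

Lemma Re_addc {R : rcfType} (x y : R[i]) : Re (x + y) = Re x + Re y.
Proof. by case: x => ? ?; case: y. Qed.

Lemma Im_addc {R : rcfType} (x y : R[i]) : Im (x + y) = Im x + Im y.
Proof. by case: x => ? ?; case: y. Qed.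

Lemma Re_oppc {R : rcfType} (x : R[i]) : Re (- x) = - Re x.
Proof. by case: x. Qed.

Lemma Im_oppc {R : rcfType} (x : R[i]) : Im (- x) = - Im x.
Proof. by case: x. Qed.

Lemma sqnormcM {R : rcfType} (x y : R[i]) :
  sqnormc (x * y) = sqnormc x * sqnormc y.
Proof. rewrite /sqnormc Re_mulc Im_mulc; ring. Qed.

Lemma sqnormc_real {R : rcfType} (k : R) : sqnormc k%:C = k ^+ 2.
Proof. by rewrite /sqnormc /= expr0n addr0. Qed.

Lemma sqnormc_ge0 {R : rcfType} (x : R[i]) : 0 <= sqnormc x.
Proof. by rewrite addr_ge0 ?sqr_ge0. Qed.

Lemma sqnormc_eq0 {R : rcfType} (x : R[i]) : (sqnormc x == 0) = (x == 0).
Proof. by rewrite paddr_eq0 ?sqr_ge0// !sqrf_eq0 eq_complex. Qed.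

Lemma sqnormc_gt0 {R : rcfType} (x : R[i]) : (0 < sqnormc x) = (x != 0).
Proof. by rewrite lt0r sqnormc_ge0 sqnormc_eq0 andbT. Qed.

Lemma Re_le_sqnormc {R : rcfType} (x : R[i]) (k : R) :
  0 <= k -> sqnormc x <= k ^+ 2 -> `|Re x| <= k.
Proof.
move=> k0 xk; rewrite -(@ler_pXn2r _ 2)// ?nnegrE// real_normK ?num_real//.
by apply: le_trans xk; rewrite lerDl sqr_ge0.
Qed.

Lemma Im_le_sqnormc {R : rcfType} (x : R[i]) (k : R) :
  0 <= k -> sqnormc x <= k ^+ 2 -> `|Im x| <= k.
Proof.
move=> k0 xk; rewrite -(@ler_pXn2r _ 2)// ?nnegrE// real_normK ?num_real//.
by apply: le_trans xk; rewrite lerDr sqr_ge0.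
Qed.

(** * The parabolic map on a thin sector *)

(** First-order expansion of [(1 + i t)^n], by induction: multiplying by [1 + i t] adds the two old
    errors, and the product of [i t] with [i n t] contributes [- n t^2], so [C] becomes
    [2 C + n]. *)
Lemma Re_Im_expn_near1 {R : rcfType} (n : nat) :
  exists2 C : R, 0 <= C & forall t : R, `|t| <= 1 ->
    `|Re ((1 +i* t) ^+ n) - 1| <= C * t ^+ 2 /\
    `|Im ((1 +i* t) ^+ n) - n%:R * t| <= C * t ^+ 2.
Proof.
elim: n => [|n [C C0 IH]].
  by by exists 0 => // t _; rewrite expr0 /= subrr !mul0r subrr normr0.
exists (2 * C + n%:R) => [|t t1]; first by rewrite addr_ge0 ?mulr_ge0.
have [HP HQ] := IH _ t1.
rewrite exprS Re_mulc Im_mulc /= !mul1r; move: HP HQ.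
set P := Re _; set Q := Im _ => HP HQ.
have nt : 0 <= n%:R * t ^+ 2 by apply: mulr_ge0 => //; exact: sqr_ge0.
split.
  have -> : P - t * Q - 1 = (P - 1) - t * (Q - n%:R * t) - n%:R * t ^+ 2 by ring.
  apply: le_trans (ler_normB _ _) _; rewrite (ger0_norm nt).
  rewrite mulrDl lerD2r; apply: le_trans (ler_normB _ _) _.
  rewrite mulrDl mul1r mulrDl lerD// normrM.
  by apply: le_trans HQ; rewrite ler_piMl.
have -> : Q + t * P - n.+1%:R * t = (Q - n%:R * t) + t * (P - 1) by rewrite -natr1; ring.
apply: le_trans (ler_normD _ _) _; rewrite normrM.
have : `|t| * `|P - 1| <= `|P - 1| by rewrite ler_piMl.
lra.
Qed.

(* In polar terms [w ^+ n] turns n times as fast as [w], so subtracting it pushes the boundary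
   of the sector inwards, by an amount of order [theta * s ^+ n] that absorbs [e]. *)
Lemma sector_step {R : rcfType} (n : nat) (M theta0 : R) :
  (3 <= n)%N -> 0 <= M -> 0 < theta0 ->
  exists2 theta : R, 0 < theta <= theta0 & exists2 eps : R, 0 < eps &
  forall (s t : R) (e : R[i]), 0 < s < eps -> `|t| < theta * s ->
    `|Re e| <= M * s ^+ n.+1 -> `|Im e| <= M * s ^+ n.+1 ->
    let w1 := (s +i* t) - (s +i* t) ^+ n - e in
    [/\ `|Im w1| < theta * Re w1, s - 2 * s ^+ n <= Re w1 &
        Re w1 <= s - s ^+ n / 2].
Proof.
move=> n3 M0 theta00; have [C C0 HC] := @Re_Im_expn_near1 R n.
(* This gives [theta <= 1/4] and [C * theta <= 1/2], so the quadratic error [C * k^2] at a slope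
   [|k| < theta] is at most [theta / 2]. *)
pose theta := Num.min theta0 (1 / (2 * C + 4)).
have C4 : 0 < 2 * C + 4 by lra.
have th0 : 0 < theta by rewrite lt_min theta00 divr_gt0.
have thC : theta * (2 * C + 4) <= 1 by rewrite -ler_pdivlMr// ge_min lexx orbT.
have thle1 : theta <= 1.
  by apply: le_trans thC; rewrite ler_peMr ?ltW//; lra.
exists theta; first by rewrite th0 ge_min lexx.
have D0 : 0 < 4 * M + n%:R + 1 by have := ler0n R n; lra.
(* For [s] below this bound, [4 M s < theta] and [n s < 1]. *)
exists (theta / (4 * M + n%:R + 1)); first by rewrite divr_gt0.
move=> s t e /andP[s0]; rewrite ltr_pdivlMr// => sD.
rewrite -ltr_pdivrMr// => ts e1 e2.
have sn0 : 0 < s ^+ n by rewrite exprn_gt0.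
have n0 : 0 <= n%:R :> R by [].
have nge3 : 3 <= n%:R :> R by rewrite ler_nat.
have Ms0 : 0 <= M * s by rewrite mulr_ge0// ltW.
have ns0 : 0 <= s * n%:R by rewrite mulr_ge0// ltW.
have Ms : 4 * (M * s) < theta by lra.
have ns : s * n%:R < 1 by lra.
have sle1 : s <= 1 by lra.
pose k := t / s.
have kth : `|k| < theta by rewrite normrM normfV (gtr0_norm s0).
have [HP HQ] := HC k (le_trans (ltW kth) thle1).
have tk : t = s * k by rewrite mulrC divfK ?gt_eqF.
have wn : (s +i* t) ^+ n = (s ^+ n)%:C * (1 +i* k) ^+ n.
  rewrite rmorphXn -exprMn; congr (_ ^+ n).
  by rewrite tk; apply/eqP; rewrite eq_complex /=; apply/andP; split; apply/eqP; ring.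
rewrite wn /= !Re_addc !Im_addc !Re_oppc !Im_oppc Re_mulc Im_mulc /= !mul0r addr0 subr0.
move: HP HQ; set P := Re _ ; set Q := Im _ => HP HQ.
have k2 : k ^+ 2 <= theta ^+ 2.
  by rewrite -(@real_normK _ k) ?num_real// ler_pXn2r ?nnegrE// ltW.
have Ck : C * k ^+ 2 <= C * theta * theta by rewrite -mulrA ler_wpM2l// -expr2.
have Cth : C * theta <= 1 / 2 by nra.
have CthA : C * theta * theta <= theta / 2.
  by rewrite [leRHS]mulrC ler_wpM2r ?ltW//; lra.
have Cth0 : 0 <= C * theta by rewrite mulr_ge0// ltW.
have th4 : theta <= 1 / 4 by lra.
move: HP HQ; rewrite !ler_norml => /andP[P1 P2] /andP[Q1 Q2].
have e' (x : R) : `|x| <= M * s ^+ n.+1 -> `|x| <= s ^+ n * (M * s).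
  by move=> /le_trans; apply; rewrite exprS mulrA mulrC.
move: e1 e2 => /e' + /e'; rewrite !ler_norml => /andP[e11 e12] /andP[e21 e22].
move: kth; rewrite ltr_norml => /andP[k1 k3].
have Plo : s ^+ n * (1 - 1 / 8) <= s ^+ n * P by rewrite ler_wpM2l ?(ltW sn0)//; lra.
have Phi : s ^+ n * P <= s ^+ n * (1 + 1 / 8) by rewrite ler_wpM2l ?(ltW sn0)//; lra.
have snM : s ^+ n * (M * s) <= s ^+ n * (1 / 16) by rewrite ler_wpM2l ?(ltW sn0)//; lra.
split; last 2 first.
- lra.
- lra.
have snn : s ^+ n * n%:R <= s.
  have sN : s * (s * n%:R) <= s by rewrite ler_piMr ?ltW.
  rewrite -{1}(subnK (ltnW n3)) exprD -mulrA expr2 -mulrA.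
  apply: le_trans (sN); rewrite ler_piMl ?mulr_ge0 ?(ltW s0)//.
  by rewrite exprn_ile1// ltW.
(* Both edges of the sector at once, with [u = k] and [u = - k]. As [n s^n <= s], the slack
   [s (theta - u)] is at least [n s^n (theta - u)]; then [u] cancels, and
   [n theta s^n >= 3 theta s^n] outweighs the errors, which total at most
   [(1 + 1/8 + 1/2 + 1/2) theta s^n]. *)
have key (u : R) (q f : R) : u < theta -> n%:R * u - theta / 2 <= q ->
    - (s ^+ n * (M * s)) <= f ->
    s * u - s ^+ n * q - f <
    theta * (s - s ^+ n * P - Re e).
  move=> ut qu fe.
  have h1 : s ^+ n * (theta * P - q) <= s ^+ n * (theta + theta / 8 - n%:R * u + theta / 2).
    rewrite ler_wpM2l ?(ltW sn0)//.
    have : theta * P <= theta * (1 + 1 / 8) by rewrite ler_wpM2l ?(ltW th0)//; lra.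
    lra.
  have h2 : theta * Re e <= s ^+ n * (M * s).
    apply: le_trans (_ : theta * (s ^+ n * (M * s)) <= _); first by rewrite ler_wpM2l ?(ltW th0).
    by rewrite ler_piMl// mulr_ge0// ltW.
  have h3 : s ^+ n * (2 * (M * s)) <= s ^+ n * (theta / 2).
    by rewrite ler_wpM2l ?(ltW sn0)//; lra.
  have h4 : s ^+ n * n%:R * (theta - u) <= s * (theta - u) by rewrite ler_wpM2r//; lra.
  have h5 : s ^+ n * theta * 3 <= s ^+ n * theta * n%:R.
    by rewrite ler_wpM2l ?mulr_ge0 ?(ltW sn0) ?(ltW th0).
  have h6 : 0 < s ^+ n * theta by rewrite mulr_gt0.
  lra.
rewrite ltr_norml; apply/andP; split; last by rewrite tk; apply: key => //; lra.
rewrite ltrNl; have -> : - (t - s ^+ n * Q - Im e) = s * (- k) - s ^+ n * (- Q) - (- Im e).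
  by rewrite tk; ring.
by apply: key; lra.
Qed.

(** * Polar form and roots in the right half-plane *)

Lemma complex_polar {R : realType} (z : R[i]) :
  exists2 p : R, 0 <= p & exists2 t : R, -pi <= t <= pi &
    z = p%:C * (cos t +i* sin t).
Proof.
have [->|z0] := eqVneq z 0.
  exists 0 => //; exists 0; last by rewrite mul0r.
  by rewrite oppr_le0 pi_ge0.
have N0 : 0 < sqnormc z by rewrite sqnormc_gt0.
pose p := Num.sqrt (sqnormc z); have p0 : 0 < p by rewrite sqrtr_gt0.
have pn0 : p != 0 by rewrite gt_eqF.
have p2 : p ^+ 2 = sqnormc z by rewrite sqr_sqrtr// ltW.
have Rp : `|Re z| <= p by apply: Re_le_sqnormc; [exact: ltW|rewrite p2].
have u1 : -1 <= Re z / p <= 1.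
  by rewrite -ler_norml normrM normfV (gtr0_norm p0) ler_pdivrMr// mul1r.
have sinE : sin (acos (Re z / p)) = `|Im z| / p.
  rewrite sin_acos//.
  have -> : 1 - (Re z / p) ^+ 2 = (Im z / p) ^+ 2.
    have Iz2 : Im z ^+ 2 = p ^+ 2 - Re z ^+ 2 by rewrite p2 /sqnormc; ring.
    by rewrite !expr_div_n Iz2; field; rewrite gt_eqF.
  by rewrite sqrtr_sqr normrM normfV (gtr0_norm p0).
have cosE : cos (acos (Re z / p)) = Re z / p by rewrite acosK// in_itv.
exists p; first exact: ltW.
have [Iz|Iz] := leP 0 (Im z).
  exists (acos (Re z / p)).
    rewrite acos_lepi// andbT (le_trans _ (acos_ge0 u1))// oppr_le0 pi_ge0//.
  rewrite cosE sinE ger0_norm//; apply/eqP; rewrite eq_complex Re_mulc Im_mulc /=.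
  by rewrite !mul0r subr0 addr0 !(mulrC p) !(divfK pn0) ?eqxx.
exists (- acos (Re z / p)).
  rewrite lerN2 acos_lepi//= (le_trans _ (pi_ge0 R))// oppr_le0 acos_ge0//.
rewrite cosN sinN cosE sinE ltr0_norm//; apply/eqP; rewrite eq_complex Re_mulc Im_mulc /=.
by rewrite mulNr opprK !mul0r subr0 addr0 !(mulrC p) !(divfK pn0) ?eqxx.
Qed.

Lemma de_moivre {R : realType} (t : R) (n : nat) :
  (cos t +i* sin t) ^+ n = cos (n%:R * t) +i* sin (n%:R * t).
Proof.
elim: n => [|n IH]; first by rewrite mul0r cos0 sin0.
rewrite exprS IH -natr1 mulrDl mul1r addrC cosD sinD.
by apply/eqP; rewrite eq_complex Re_mulc Im_mulc /= eqxx; apply/eqP; ring.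
Qed.

(** If [z] has argument [t] in [[-pi, pi]], the root of argument [t / r] works: [|t / r| < pi / 2]
    holds when [r >= 3], and also when [r = 2] unless [t] is [pi] or [- pi], where [z] would be a
    negative real. *)
Lemma root_Re_gt0 {R : realType} (z : R[i]) (r : nat) : z != 0 ->
  (3 <= r)%N \/ (r = 2%N /\ ~ (exists2 t : R, t <= 0 & z = t%:C)) ->
  exists2 x : R[i], 0 < Re x & x ^+ r = z.
Proof.
move=> z0 hr; have r0 : (0 < r)%N by case: hr => [/ltnW/ltnW//|[-> _]].
have [p p0 [t tpi zE]] := complex_polar z.
have {}p0 : 0 < p.
  by rewrite lt0r p0 andbT; apply: contra_neq z0 => p0'; rewrite zE p0' mul0r.
have rR : 0 < r%:R :> R by rewrite ltr0n.
exists ((p `^ r%:R^-1)%:C * (cos (t / r%:R) +i* sin (t / r%:R))).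
  rewrite Re_mulc /= mul0r subr0 mulr_gt0 ?powR_gt0//.
  apply: cos_gt0_pihalf; have pi0 := pi_gt0 R.
  case: hr => [r3|[r2 hz]].
    have {}r3 : 3 <= r%:R :> R by rewrite ler_nat.
    rewrite ltr_pdivlMr// ltr_pdivrMr//.
    have : pi / 2 * 3 <= pi / 2 * r%:R :> R by rewrite ler_wpM2l// divr_ge0// ltW.
    by move: tpi => /andP[]; lra.
  rewrite r2 -mulNr !ltr_pM2r ?invr_gt0//.
  have hpi s : cos s = -1 -> sin s = 0 -> t <> s.
    move=> cs ss ts; apply: hz; exists (- p); first by rewrite oppr_le0 ltW.
    by rewrite zE ts cs ss; apply/eqP; rewrite eq_complex Re_mulc Im_mulc /= !mul0r !mulr0
      subr0 addr0 mulrN1 !eqxx.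
  move: tpi; rewrite !le_eqVlt => /andP[/orP[/eqP tE|->] /orP[/eqP tE'|->]] //.
  - by case: (hpi (- pi)); rewrite ?cosN ?sinN ?cospi ?sinpi ?oppr0.
  - by case: (hpi (- pi)); rewrite ?cosN ?sinN ?cospi ?sinpi ?oppr0.
  - by case: (hpi pi); rewrite ?cospi ?sinpi.
rewrite exprMn de_moivre mulrCA divff ?gt_eqF// mulr1 zE -rmorphXn /=.
by rewrite -powR_mulrn ?powR_ge0// -powRrM mulVf ?gt_eqF// powRr1// ltW.
Qed.

(** * Limits in the complex line, the plane and the projective line *)

Lemma continuous_Re {R : realType} : continuous (Re : R[i] -> R).
Proof.
move=> z; apply: (iffRL (@cvgrPdist_lt _ _ _ _ (nbhs_filter z) _ _)) => e e0.
have ? := nbhs_filter z; near=> y.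
have : `|z - y| < e%:C.
  near: y; apply/nbhs_ballP; exists e%:C => //=.
  by rewrite ltcR.
rewrite normc_def ltcR -Re_oppc -Re_addc; apply: le_lt_trans.
by apply: Re_le_sqnormc; rewrite ?sqrtr_ge0// sqr_sqrtr// sqnormc_ge0.
Unshelve. all: by end_near. Qed.

Lemma continuous_Im {R : realType} : continuous (Im : R[i] -> R).
Proof.
move=> z; apply: (iffRL (@cvgrPdist_lt _ _ _ _ (nbhs_filter z) _ _)) => e e0.
have ? := nbhs_filter z; near=> y.
have : `|z - y| < e%:C.
  near: y; apply/nbhs_ballP; exists e%:C => //=.
  by rewrite ltcR.
rewrite normc_def ltcR -Im_oppc -Im_addc; apply: le_lt_trans.
by apply: Im_le_sqnormc; rewrite ?sqrtr_ge0// sqr_sqrtr// sqnormc_ge0.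
Unshelve. all: by end_near. Qed.

Lemma cvg_complex {R : realType} {T : Type} (F : set_system T) {FF : Filter F}
    (f : T -> R[i]) (l : R[i]) :
  Re (f x) @[x --> F] --> Re l -> Im (f x) @[x --> F] --> Im l ->
  f x @[x --> F] --> l.
Proof.
move=> /cvgrPdist_lt fR /cvgrPdist_lt fI; apply/cvgrPdist_lt => -[e e'].
(* The radius is itself a complex number; its positivity forces the imaginary part to be zero. *)
rewrite ltcE /= => /andP[/eqP -> e0].
have e20 : 0 < e / 2 by rewrite divr_gt0.
near=> x; rewrite normc_def ltcR Re_addc Im_addc Re_oppc Im_oppc.
have : `|Re l - Re (f x)| < e / 2 by near: x; exact: fR.
have : `|Im l - Im (f x)| < e / 2 by near: x; exact: fI.
rewrite !ltr_norml => /andP[? ?] /andP[? ?].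
rewrite -(ger0_norm (ltW e0)) -sqrtr_sqr ltr_sqrt; nra.
Unshelve. all: by end_near. Qed.

Lemma cvg_C2 {R : realType} {T : Type} (F : set_system T) {FF : Filter F}
    (f g : T -> R[i]) (x y : R[i]) :
  f t @[t --> F] --> x -> g t @[t --> F] --> y ->
  (f t, g t) @[t --> F] --> ((x, y) : C2 R).
Proof. exact: (@cvg_pair _ _ _ F _ _ FF (nbhs_filter x) (nbhs_filter y)). Qed.

Lemma cvg_complex0 {R : realType} (u : (R[i])^nat) (s : R^nat) (k : R) :
  0 <= k -> (forall n, 0 <= s n) -> (forall n, sqnormc (u n) <= (k * s n) ^+ 2) ->
  s n @[n --> \oo] --> 0 -> u n @[n --> \oo] --> 0.
Proof.
move=> k0 s0 us s_cvg.
have ks : k * s n @[n --> \oo] --> 0 by rewrite -(mulr0 k); apply: cvgM => //; exact: cvg_cst.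
have ks' : - (k * s n) @[n --> \oo] --> 0 by rewrite -oppr0; exact: cvgN.
by apply: cvg_complex; apply: (squeeze_cvgr _ ks' ks); near=> n;
  rewrite -ler_norml; [apply: Re_le_sqnormc|apply: Im_le_sqnormc]; rewrite ?mulr_ge0.
Unshelve. all: by end_near. Qed.

(** The sequence is nonincreasing and bounded below, and its limit [L >= 0] satisfies
    [L <= L - L^m / 2], hence [L^m = 0]. *)
Lemma cvg_decr_expn {R : realType} (s : R^nat) (m : nat) :
  (forall n, 0 <= s n) -> (forall n, s n.+1 <= s n - s n ^+ m / 2) ->
  s n @[n --> \oo] --> 0.
Proof.
move=> s0 sS.
have s_cvg : cvgn s.
  apply: nonincreasing_is_cvgn; last by exists 0 => _ [n _ <-].
  apply/nonincreasing_seqP => n; apply: le_trans (sS n) _.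
  by rewrite gerBl divr_ge0 ?exprn_ge0.
suff -> : 0 = limn s by [].
have lim0 : 0 <= limn s by apply: limr_ge => //; near=> n.
have sS_cvg : s n.+1 @[n --> \oo] --> limn s by rewrite cvg_shiftS.
have sm_cvg : s n - s n ^+ m / 2 @[n --> \oo] --> limn s - limn s ^+ m / 2.
  apply: cvgB => //; apply: cvgM; last exact: cvg_cst.
  exact: (continuous_cvg _ (@exprn_continuous _ m _)).
have : limn s <= limn s - limn s ^+ m / 2.
  by apply: ler_cvg_to sS_cvg sm_cvg _; near=> n.
rewrite lerBrDr gerDl pmulr_lle0 ?invr_gt0// => lim_le0.
have : limn s ^+ m = 0 by apply/le_anti; rewrite lim_le0 exprn_ge0.
by move/eqP; rewrite expf_eq0 => /andP[_ /eqP].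
Unshelve. all: by end_near. Qed.

(** In the continuous affine chart [y |-> [1 : y]], the class of [u n] has coordinate
    [(u n).2 / (u n).1] and [[1 : 0]] has coordinate 0. *)
Lemma cvg_P1_e1 {R : realType} (u : nat -> C2 R) (u0 : forall n, u n <> 0) :
  (forall n, (u n).1 != 0) ->
  (u n).2 / (u n).1 @[n --> \oo] --> 0 ->
  P1_class (u0 n) @[n --> \oo] --> P1_e1 R.
Proof.
move=> x0 cv.
have v0 (y : R[i]) : ((1, y) : C2 R) <> 0 by move=> [] /eqP; rewrite oner_eq0.
pose chart (y : R[i]) : C2star R := exist _ (1, y) (mem_set (v0 y)).
have chart_cont : continuous chart.
  apply: continuous_comp_initial => y; have yF : Filter (nbhs y) := nbhs_filter y.
  by apply: cvg_C2; [exact: cvg_cst|exact: cvg_id].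
have -> : (fun n => P1_class (u0 n)) =
    (fun n => \pi_(P1 R)%qT (chart ((u n).2 / (u n).1))).
  apply/funext => n; apply/eqmodP/asboolP; exists (u n).1; split => //=.
  by rewrite [RHS]surjective_pairing /= /GRing.scale/= mulr1 mulrC divfK// -surjective_pairing.
have -> : P1_e1 R = \pi_(P1 R)%qT (chart 0).
  by congr (\pi_(P1 R)%qT _); apply: val_inj.
apply: continuous_cvg; first exact: pi_continuous.
by apply: continuous_cvg; first exact: chart_cont.
Qed.

Lemma cvg_complexM {R : realType} {T : Type} (F : set_system T) {FF : Filter F}
    (f g : T -> R[i]) (x y : R[i]) :
  f t @[t --> F] --> x -> g t @[t --> F] --> y -> f t * g t @[t --> F] --> x * y.
Proof. exact: cvgM. Qed.

Lemma cvg_expn {R : realType} {T : Type} (F : set_system T) {FF : Filter F}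
    (f : T -> R) (l : R) (n : nat) :
  f x @[x --> F] --> l -> f x ^+ n @[x --> F] --> l ^+ n.
Proof. by move=> fl; exact: (continuous_cvg _ (@exprn_continuous R n l) fl). Qed.

(** * Openness and connectedness of the cusp *)

Lemma open_lt_fun {R : realType} {T : topologicalType} (f g : T -> R) :
  continuous f -> continuous g -> open [set x | f x < g x].
Proof.
move=> cf cg; have -> : [set x | f x < g x] = (fun x => f x - g x) @^-1` [set y | y < 0].
  by apply/seteqP; split=> x /=; rewrite subr_lt0.
apply: open_comp; last exact: open_lt.
by move=> x _; apply: cvgB; [exact: cf|exact: cg].
Qed.

(* [z.1 = zeta * (s + i t)] with [s + i t] in a thin triangle, and [`|z.2| < s ^ n]. *)
Definition cusp {R : realType} (zeta : R[i]) (n : nat) (theta eps : R) : set (C2 R) :=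
  [set z | [/\ Re (z.1 / zeta) < eps, `|Im (z.1 / zeta)| < theta * Re (z.1 / zeta) &
               sqnormc z.2 < (Re (z.1 / zeta) ^+ n) ^+ 2]].

Lemma cusp_open {R : realType} (zeta : R[i]) (n : nat) (theta eps : R) :
  open (cusp zeta n theta eps).
Proof.
have cR1 : continuous (fun z : C2 R => Re z.1).
  by move=> z; apply: (continuous_comp (@cvg_fst _ _ _ _ _)); exact: continuous_Re.
have cI1 : continuous (fun z : C2 R => Im z.1).
  by move=> z; apply: (continuous_comp (@cvg_fst _ _ _ _ _)); exact: continuous_Im.
have cR2 : continuous (fun z : C2 R => Re z.2).
  by move=> z; apply: (continuous_comp (@cvg_snd _ _ _ _ _)); exact: continuous_Re.
have cI2 : continuous (fun z : C2 R => Im z.2).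
  by move=> z; apply: (continuous_comp (@cvg_snd _ _ _ _ _)); exact: continuous_Im.
have cR : continuous (fun z : C2 R => Re (z.1 / zeta)).
  under [X in continuous X]eq_fun do rewrite Re_mulc.
  by move=> z; apply: cvgB; apply: cvgM; try exact: cvg_cst; [exact: cR1|exact: cI1].
have cI : continuous (fun z : C2 R => Im (z.1 / zeta)).
  under [X in continuous X]eq_fun do rewrite Im_mulc.
  by move=> z; apply: cvgD; apply: cvgM; try exact: cvg_cst; [exact: cR1|exact: cI1].
have -> : cusp zeta n theta eps =
    [set z | Re (z.1 / zeta) < eps] `&`
    [set z | `|Im (z.1 / zeta)| < theta * Re (z.1 / zeta)] `&`
    [set z | sqnormc z.2 < (Re (z.1 / zeta) ^+ n) ^+ 2].
  by apply/seteqP; split => z /=; [case|case; case].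
apply: openI; [apply: openI|]; apply: open_lt_fun => z.
- exact: cR.
- exact: cvg_cst.
- by apply: cvg_norm; exact: cI.
- by apply: cvgM; [exact: cvg_cst|exact: cR].
- by apply: cvgD; apply: cvg_expn;
    [exact: cR2|exact: cI2].
- do 2 apply: cvg_expn; exact: cR.
Qed.

Lemma cusp_Re_gt0 {R : realType} {zeta : R[i]} {n : nat} {theta eps : R} {z : C2 R} :
  0 < theta -> cusp zeta n theta eps z -> 0 < Re (z.1 / zeta).
Proof.
move=> th0 [_ tz _]; rewrite -(pmulr_rgt0 _ th0).
exact: le_lt_trans tz.
Qed.

(** Each point is joined inside the cusp to the common point [(zeta * eps / 2, 0)]. *)
Lemma cusp_connected {R : realType} (zeta : R[i]) (n : nat) (theta eps : R) :
  zeta != 0 -> 0 < theta -> 0 < eps -> connected (cusp zeta n theta eps).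
Proof.
move=> zeta0 th0 eps0.
pose s (z : C2 R) : R := Re (z.1 / zeta); pose t (z : C2 R) : R := Im (z.1 / zeta).
pose sT (z : C2 R) (k : R) := eps / 2 + k * (s z - eps / 2).
(* A straight segment may leave the cusp, so [z.2] is first divided by the width [s^n] at [z], then
   multiplied by [k] and by the width at the current abscissa. *)
pose path (z : C2 R) (k : R) : C2 R :=
  (zeta * (sT z k +i* (k * t z)), (k * sT z k ^+ n)%:C * (z.2 / (s z ^+ n)%:C)).
have path_cont z : continuous (path z).
  have sT_cont : continuous (sT z).
    by move=> k; apply: cvgD; [exact: cvg_cst|apply: cvgM; [exact: cvg_id|exact: cvg_cst]].
  have sTn_cont : continuous (fun k : R => k * sT z k ^+ n).
    move=> k; apply: cvgM; first exact: cvg_id.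
    by apply: cvg_expn; exact: sT_cont.
  have t_cont : continuous (fun k : R => k * t z).
    by move=> k; apply: cvgM; [exact: cvg_id|exact: cvg_cst].
  move=> k; apply: cvg_C2; apply: cvg_complexM.
  - exact: cvg_cst.
  - by apply: cvg_complex; [exact: sT_cont|exact: t_cont].
  - by apply: cvg_complex; [exact: sTn_cont|exact: cvg_cst].
  - exact: cvg_cst.
have path_cusp z k : cusp zeta n theta eps z -> 0 <= k <= 1 ->
    cusp zeta n theta eps (path z k).
  move=> zC /andP[k0 k1]; have s0 := cusp_Re_gt0 th0 zC.
  case: zC; rewrite -/(s z) -/(t z) => s1 t1 y1.
  have wE : (path z k).1 / zeta = sT z k +i* (k * t z).
    by rewrite /path /= mulrC mulKf.
  have sT0 : 0 < sT z k by rewrite /sT -/(s z) in s0 *; nra.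
  split; rewrite ?wE /=.
  - rewrite /sT; nra.
  - rewrite normrM (ger0_norm k0) /sT.
    (* For [k < 1] strictness comes from the centre's share [theta * (eps / 2) * (1 - k)]; at
       [k = 1] this vanishes and the strict inequality at [z] itself is used. *)
    have [->|kn1] := eqVneq k 1; first by lra.
    have {}k1 : k < 1 by rewrite lt_neqAle kn1.
    have : 0 < theta * (eps / 2) * (1 - k).
      by rewrite !mulr_gt0 ?subr_gt0.
    have : 0 <= k * (theta * s z - `|t z|) by rewrite mulr_ge0// subr_ge0 ltW.
    lra.
  - have sn0 : 0 < (s z ^+ n) ^+ 2 by rewrite !exprn_gt0.
    have sTn0 : 0 < (sT z k ^+ n) ^+ 2 by rewrite !exprn_gt0.
    have u1 : sqnormc (z.2 / (s z ^+ n)%:C) < 1.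
      rewrite -(ltr_pM2r sn0) mul1r -sqnormc_real -sqnormcM divfK ?sqnormc_real//.
      by rewrite fmorph_eq0 expf_eq0 gt_eqF// andbF.
    rewrite sqnormcM sqnormc_real exprMn.
    apply: le_lt_trans (_ : (sT z k ^+ n) ^+ 2 * sqnormc (z.2 / (s z ^+ n)%:C) < _).
      by rewrite ler_wpM2r ?sqnormc_ge0// ler_piMl ?(ltW sTn0)// exprn_ile1.
    by rewrite gtr_pMr.
have -> : cusp zeta n theta eps =
    \bigcup_(z in cusp zeta n theta eps) path z @` `[0, 1].
  apply/seteqP; split => [z zC|z [x xC [k]]]; last first.
    by rewrite /= in_itv /= => k01 <-; exact: path_cusp.
  exists z => //; exists 1; first by rewrite /= in_itv /= ler01 lexx.
  have s0 := cusp_Re_gt0 th0 zC.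
  rewrite /path /sT !mul1r subrKC [z in RHS]surjective_pairing; congr (_, _).
    have -> : s z +i* t z = z.1 / zeta by rewrite /s /t; case: (_ / _).
    by rewrite mulrC divfK.
  rewrite mulrC divfK// eq_complex /= expf_eq0 gt_eqF// ?andbF//.
apply: bigcup_connected.
  exists (zeta * (eps / 2)%:C, 0) => z zC; exists 0; first by rewrite /= in_itv /= lexx ler01.
  by rewrite /path /sT !mul0r addr0.
move=> z zC; apply: connected_continuous_connected; first exact: segment_connected.
exact: continuous_subspaceT.
Qed.

(** * Invariance of the cusp *)

Lemma Bernoulli_le {R : realFieldType} (x : R) (n : nat) :
  0 <= x <= 1 -> 1 - n%:R * x <= (1 - x) ^+ n.
Proof.
move=> /andP[x0 x1]; elim: n => [|n IH]; first by rewrite mul0r subr0.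
rewrite exprSr; apply: le_trans (_ : (1 - n%:R * x) * (1 - x) <= _).
  by rewrite -natr1; have := ler0n R n; nra.
by rewrite ler_wpM2r// subr_ge0.
Qed.

(** [sector_step] handles the first coordinate. For the second, both sides are compared with
    [1 - 2 n s^2]: it bounds [|1 - x|] from above, because [|1 - x|^2 <= 1 - c s + K s^2], and it
    bounds [(s' / s)^n] from below, by Bernoulli. *)
Lemma cusp_step {R : realType} (a zeta : R[i]) (r : nat) :
  (2 <= r)%N -> a * zeta ^+ r = -1 -> 0 < Re zeta ->
  exists2 theta : R, 0 < theta <= 1 & exists2 eps : R, 0 < eps <= 1 &
  forall z, cusp zeta r.+1 theta eps z ->
    let z1 := (z.1 - z.2 ^+ 2 + a * z.1 ^+ r.+1, z.2 - z.1 * z.2) in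
    cusp zeta r.+1 theta eps z1 /\
    Re (z1.1 / zeta) <= Re (z.1 / zeta) - Re (z.1 / zeta) ^+ r.+1 / 2.
Proof.
move=> r2 az c0; set n := r.+1; set c := Re zeta in c0; pose d := Im zeta.
have zeta0 : zeta != 0 by apply: contraTneq c0; rewrite /c => ->; rewrite ltxx.
have N1B (u v : R) : sqnormc (1 - zeta * (u +i* v)) =
    1 - 2 * (c * u - d * v) + sqnormc zeta * (u ^+ 2 + v ^+ 2).
  rewrite /sqnormc Re_addc Im_addc Re_oppc Im_oppc Re_mulc Im_mulc /= -/c -/d; ring.
have n0 : 0 <= n%:R :> R by [].
have d1 : 0 < 2 * (`|d| + 1) by rewrite mulr_gt0// ltr_wpDl.
pose K := 2 * sqnormc zeta; have K0 : 0 <= K by rewrite mulr_ge0// sqnormc_ge0.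
(* Since [u <= (1 + u)^2] for [u >= 0], this bounds the modulus of [zeta^-1] without a square
   root. *)
pose M := 1 + sqnormc zeta^-1.
have M0 : 0 <= M by rewrite addr_ge0// sqnormc_ge0.
(* The second bound gives [2 d t <= c s], so the tilt of [zeta] costs at most half of the gain
   [2 c s] in [|1 - x|^2]. *)
have theta00 : 0 < Num.min 1 (c / (2 * (`|d| + 1))) by rewrite lt_min ltr01 divr_gt0.
have [theta /andP[th0]] := sector_step _ _ _ (r2 : (3 <= n)%N) M0 theta00.
rewrite le_min ler_pdivlMr// => /andP[th1 thd] [eps1 eps10 step].
have D0 : 0 < K + 4 * n%:R + 1 by lra.
(* In order: for [sector_step]; for [s < 1]; for [K s^2 + 4 n s^2 <= c s]; for [2 n s^2 <= 1/2],
   which keeps the comparison factor positive. *)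
pose eps := Num.min (Num.min eps1 1) (Num.min (c / (K + 4 * n%:R + 1)) (1 / (4 * n%:R))).
have n40 : 0 < 4 * n%:R :> R by rewrite mulr_gt0// ltr0n.
have eps0 : 0 < eps by rewrite !lt_min eps10 ltr01 !divr_gt0.
exists theta; first by rewrite th0.
exists eps; first by rewrite eps0 /= ge_min ge_min lexx orbT.
move=> z zC; have s0 := cusp_Re_gt0 th0 zC; case: zC.
set s := Re _ in s0 *; set t := Im _ => s_eps st sy.
move=> z1.
have := s_eps; rewrite !lt_min !ltr_pdivlMr// => /andP[/andP[s1 s2] /andP[s3 s4]].
have wE : z.1 / zeta = s +i* t by rewrite /s /t; case: (_ / _).
have xE : z.1 = zeta * (s +i* t) by rewrite -wE mulrC divfK.
pose e := z.2 ^+ 2 / zeta.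
have z1E : z1.1 / zeta = (s +i* t) - (s +i* t) ^+ n - e.
  have p0 : zeta ^+ r != 0 by rewrite expf_neq0.
  have aE : a = - (zeta ^+ r)^-1 by apply: (mulIf p0); rewrite az mulNr mulVf.
  rewrite /z1 /= -wE /e expr_div_n /n !exprS aE.
  by field; rewrite zeta0 p0.
have sn0 : 0 < s ^+ n by rewrite exprn_gt0.
(* Here [|y|^2 < s^(2 n) <= s^(n + 1)] because [s < 1]. *)
have eM : sqnormc e <= (M * s ^+ n.+1) ^+ 2.
  rewrite /e expr2 !sqnormcM -/n exprMn mulrC.
  have zM : sqnormc zeta^-1 <= M ^+ 2 by rewrite /M; have := sqnormc_ge0 zeta^-1; nra.
  apply: ler_pM => //; rewrite ?mulr_ge0 ?sqnormc_ge0//.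
  have sns : (s ^+ n) ^+ 2 <= s ^+ n.+1.
    rewrite expr2 exprS ler_wpM2r ?(ltW sn0)// /n exprS ler_piMr ?(ltW s0)//.
    by rewrite exprn_ile1 ?(ltW s0) ?(ltW s2).
  have ysn : sqnormc z.2 <= s ^+ n.+1 by apply: le_trans sns; exact: ltW.
  by rewrite [leRHS]expr2; apply: ler_pM => //; exact: sqnormc_ge0.
have MS0 : 0 <= M * s ^+ n.+1 by rewrite mulr_ge0// exprn_ge0// ltW.
have := step s t e.
rewrite s0 s1 => /(_ isT st (Re_le_sqnormc _ _ MS0 eM) (Im_le_sqnormc _ _ MS0 eM)).
rewrite -z1E; cbv zeta; set s' := Re _; set t' := Im _ => -[st' s'lo s'hi].
split => //; split => //.
  by apply: le_lt_trans s_eps; apply: le_trans s'hi _; rewrite gerBl divr_ge0 ?ltW.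
rewrite -/s' /z1 /=.
have s20 : 0 <= s ^+ 2 := sqr_ge0 s.
(* As [n >= 3], the loss [2 s^n] is at most [2 s^3], a relative loss of order [s^2]. *)
have snle : s ^+ n <= s * s ^+ 2.
  by rewrite -exprS -(subnK (r2 : (3 <= n)%N)) exprD ler_piMl ?exprn_ge0 ?exprn_ile1 ?ltW.
have s'lo' : s * (1 - 2 * s ^+ 2) <= s' by lra.
have ns1 : 2 * (n%:R * s ^+ 2) <= 1 / 2.
  have : n%:R * s * s <= n%:R * s by rewrite ler_piMr ?mulr_ge0 ?(ltW s0) ?(ltW s2)//.
  lra.
have x21 : 0 <= 2 * s ^+ 2 <= 1.
  have : s ^+ 2 <= n%:R * s ^+ 2 by rewrite ler_peMl// ler1n.
  lra.
have s'n : s ^+ n * (1 - n%:R * (2 * s ^+ 2)) <= s' ^+ n.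
  apply: le_trans (_ : (s * (1 - 2 * s ^+ 2)) ^+ n <= _).
    by rewrite exprMn ler_wpM2l ?(ltW sn0)// Bernoulli_le.
  by rewrite lerXn2r ?nnegrE//; nra.
have -> : z.2 - z.1 * z.2 = z.2 * (1 - z.1) by ring.
have x1 : sqnormc (1 - z.1) <= (1 - n%:R * (2 * s ^+ 2)) ^+ 2.
  rewrite xE N1B.
  have ts : `|t| <= s by apply: le_trans (ltW st) _; rewrite ler_piMl ?(ltW s0).
  have t2 : t ^+ 2 <= s ^+ 2.
    by rewrite -[t ^+ 2]real_normK ?num_real// ler_pXn2r ?nnegrE// ltW.
  have Kt : sqnormc zeta * (s ^+ 2 + t ^+ 2) <= K * s ^+ 2.
    have : sqnormc zeta * t ^+ 2 <= sqnormc zeta * s ^+ 2.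
      by rewrite ler_wpM2l ?sqnormc_ge0.
    rewrite /K; lra.
  have dt : 2 * (d * t) <= c * s.
    have : d * t <= `|d| * (theta * s).
      apply: le_trans (ler_norm _) _; rewrite normrM.
      by rewrite ler_wpM2l// ltW.
    have : theta * (2 * (`|d| + 1)) * s <= c * s by rewrite ler_wpM2r// ltW.
    have : 0 < theta * s by rewrite mulr_gt0.
    lra.
  have s3' : s * (K + 4 * n%:R + 1) * s <= c * s by rewrite ler_wpM2r ?ltW.
  have : 0 <= (n%:R * (2 * s ^+ 2)) ^+ 2 by exact: sqr_ge0.
  lra.
have k0 : 0 < 1 - n%:R * (2 * s ^+ 2) by lra.
rewrite sqnormcM; apply: lt_le_trans (_ : (s ^+ n * (1 - n%:R * (2 * s ^+ 2))) ^+ 2 <= _).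
  rewrite exprMn; apply: le_lt_trans (_ : sqnormc z.2 * (1 - n%:R * (2 * s ^+ 2)) ^+ 2 < _).
    by rewrite ler_wpM2l ?sqnormc_ge0.
  by rewrite ltr_pM2r// exprn_gt0.
by rewrite ler_pXn2r ?nnegrE// ?mulr_ge0 ?(ltW sn0) ?(ltW k0)// (le_trans _ s'n)//
  mulr_ge0 ?(ltW sn0) ?(ltW k0).
Qed.

(** * The origin as boundary point, and convergence of orbits *)

(** The axis points [(zeta * k, 0)] with small [k > 0] lie in the cusp and tend to 0, while 0 is
    outside it. *)
Lemma cusp_boundary0 {R : realType} (zeta : R[i]) (n : nat) (theta eps : R) :
  zeta != 0 -> 0 < theta -> 0 < eps -> boundary (cusp zeta n theta eps) 0.
Proof.
move=> zeta0 th0 eps0; split; last first.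
  by move/interior_subset/(cusp_Re_gt0 th0); rewrite mul0r ltxx.
pose f (k : R) : C2 R := (zeta * k%:C, 0).
have f0 : f k @[k --> 0^'+] --> (0 : C2 R).
  have -> : (0 : C2 R) = (zeta * 0, 0) by rewrite mulr0.
  apply: cvg_C2; last exact: cvg_cst.
  apply: cvg_complexM; first exact: cvg_cst.
  by apply: cvg_complex; [exact: cvg_at_right_filter|exact: cvg_cst].
move=> B /f0 fB.
suff [k [kC kB]] : exists k, cusp zeta n theta eps (f k) /\ B (f k) by exists (f k).
apply: (@filter_ex _ (0^'+ : set_system R)); near=> k; split; last by near: k; exact: fB.
have k0 : 0 < k by [].
have fE : (f k).1 / zeta = k%:C by rewrite /f /= mulrC mulKf.
split; rewrite fE /=; first by near: k; exact: nbhs_right_lt.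
  by rewrite normr0 mulr_gt0.
by rewrite /sqnormc /= expr0n addr0 !exprn_gt0.
Unshelve. all: by end_near. Qed.

(** Along an orbit [s = Re (x / zeta)] tends to 0 by the decrease hypothesis and controls the rest:
    [|x|] is at most a constant times [s], [|y| <= s^2] as [n >= 2], and [|x| >= |zeta| s], so
    [y / x] is also at most a constant times [s]. *)
Lemma cusp_domain_of_attraction {R : realType} (F : C2 R -> C2 R) (zeta : R[i])
    (n : nat) (theta eps : R) :
  (2 <= n)%N -> zeta != 0 -> 0 < theta <= 1 -> 0 < eps <= 1 ->
  (forall z, cusp zeta n theta eps z -> cusp zeta n theta eps (F z) /\
     Re ((F z).1 / zeta) <= Re (z.1 / zeta) - Re (z.1 / zeta) ^+ n / 2) ->
  domain_of_attraction F (P1_e1 R) (cusp zeta n theta eps).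
Proof.
move=> n2 zeta0 /andP[th0 th1] /andP[eps0 eps1] step.
have bd0 := @cusp_boundary0 _ _ n _ _ zeta0 th0 eps0.
split.
  split; [|exact: cusp_open|exact: cusp_connected].
  by have [/(_ _ filterT)[z [zC _]] _] := bd0; exists z.
split=> //; split=> [_ [z zC <-]|z zC]; first exact: (step _ zC).1.
pose u k := iter k F z.
have uC k : cusp zeta n theta eps (u k).
  by elim: k => // k IH; exact: (step _ IH).1.
pose s k := Re ((u k).1 / zeta).
have s0 k : 0 < s k := cusp_Re_gt0 th0 (uC k).
have s_cvg : s k @[k --> \oo] --> 0.
  apply: (@cvg_decr_expn _ _ n) => k; first exact: ltW.
  exact: (step _ (uC k)).2.
have s1 k : s k <= 1 by case: (uC k) => /ltW h _ _; exact: le_trans eps1.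
have x_neq0 k : (u k).1 != 0.
  by apply: contraTneq (s0 k) => x0; rewrite /s x0 mul0r ltxx.
have Nx k : sqnormc (u k).1 = sqnormc zeta * sqnormc ((u k).1 / zeta).
  by rewrite -sqnormcM mulrC divfK.
have Ny k : sqnormc (u k).2 <= (s k ^+ 2) ^+ 2.
  case: (uC k) => _ _ /ltW h; apply: le_trans h _.
  rewrite ler_pXn2r ?nnegrE ?exprn_ge0 ?(ltW (s0 k))//.
  by apply: ler_wiXn2l (s1 k) _ _ n2; exact: ltW.
have u_neq0 k : u k <> 0 by move=> uk0; move: (x_neq0 k); rewrite uk0 eqxx.
split.
  have -> : (fun k => iter k F z) = (fun k => ((u k).1, (u k).2)).
    by apply/funext => k; rewrite -surjective_pairing.
  apply: cvg_C2.
    (* The square of this constant exceeds [2 * sqnormc zeta], which bounds [|x|^2 / s^2] since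
       [|Im (x / zeta)| <= s]. *)
    apply: (@cvg_complex0 _ _ s (1 + 2 * sqnormc zeta)) => // [|k|k].
    - by rewrite addr_ge0// mulr_ge0// sqnormc_ge0.
    - exact: ltW.
    have ts : `|Im ((u k).1 / zeta)| <= s k.
      by case: (uC k) => _ /ltW h _; apply: le_trans h _; rewrite -/(s k) ler_piMl// ltW.
    have ts2 : Im ((u k).1 / zeta) ^+ 2 <= s k ^+ 2.
      by rewrite -real_normK ?num_real// ler_pXn2r ?nnegrE// ltW.
    rewrite Nx exprMn; apply: le_trans (_ : sqnormc zeta * (2 * s k ^+ 2) <= _).
      by rewrite ler_wpM2l ?sqnormc_ge0// /sqnormc -/(s k); lra.
    rewrite mulrA ler_wpM2r ?sqr_ge0//.
    by have := sqnormc_ge0 zeta; nra.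
  apply: (@cvg_complex0 _ _ s 1) => // [k|k]; first exact: ltW.
  apply: le_trans (Ny k) _; rewrite mul1r ler_pXn2r ?nnegrE ?sqr_ge0 ?(ltW (s0 k))//.
  by rewrite expr2 ler_piMl// ltW.
exists u_neq0; apply: cvg_P1_e1 => //.
apply: (@cvg_complex0 _ _ s (1 + sqnormc zeta^-1)) => // [|k|k].
- by rewrite addr_ge0// sqnormc_ge0.
- exact: ltW.
have Nx0 : 0 < sqnormc (u k).1 by rewrite sqnormc_gt0.
rewrite -(ler_pM2r Nx0) -sqnormcM (divfK (x_neq0 k)); apply: le_trans (Ny k) _.
have zz : 1 <= (1 + sqnormc zeta^-1) ^+ 2 * sqnormc zeta.
  have : sqnormc zeta * sqnormc zeta^-1 = 1.
    by rewrite -sqnormcM divff// (sqnormc_real 1) expr1n.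
  have := sqnormc_ge0 zeta; have := sqnormc_ge0 zeta^-1.
  nra.
have sw : s k ^+ 2 <= sqnormc ((u k).1 / zeta) by rewrite lerDl sqr_ge0.
have s2 : 0 <= s k ^+ 2 := sqr_ge0 _.
rewrite Nx; set w := sqnormc (_ / _) in sw *; set c := 1 + _ in zz *.
have -> : (c * s k) ^+ 2 * (sqnormc zeta * w) = c ^+ 2 * sqnormc zeta * s k ^+ 2 * w by ring.
rewrite [leLHS]expr2; apply: ler_pM => //.
by rewrite ler_peMl.
Qed.

Theorem theorem2 (R : realType) (a : R[i]) (r : nat)
    (har : (a != 0 /\ (3 <= r)%N) \/
           ((~ exists t : R, 0 <= t /\ a = t%:C) /\ r = 2%N)) :
  exists Omega : set (C2 R),
    domain_of_attraction
      (fun z => (z.1 - z.2 ^+ 2 + a * z.1 ^+ r.+1, z.2 - z.1 * z.2))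
      (P1_e1 R) Omega.
Proof.
have a0 : a != 0.
  case: har => [[]//|[ha _]].
  by apply/eqP => a0; apply: ha; exists 0; rewrite lexx a0.
have r2 : (2 <= r)%N by case: har => [[_ /ltnW]|[_ ->]].
have [zeta zeta_gt0 zetaE] : exists2 zeta : R[i], 0 < Re zeta & zeta ^+ r = - a^-1.
  apply: root_Re_gt0; first by rewrite oppr_eq0 invr_eq0.
  (* If [- a^-1] were a real [t <= 0], then [a = - t^-1] would be a nonnegative real. *)
  case: har => [[_ r3]|[ha ->]]; [by left|right; split=> // -[t t0 at_]].
  apply: ha; exists (- t^-1); rewrite oppr_ge0 invr_le0; split=> //.
  by rewrite rmorphN fmorphV /= -at_ invrN opprK invrK.
have zeta0 : zeta != 0 by apply: contraTneq zeta_gt0 => ->; rewrite ltxx.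
have azeta : a * zeta ^+ r = -1 by rewrite zetaE mulrN divff.
have [theta th [eps heps step]] := @cusp_step _ _ _ _ r2 azeta zeta_gt0.
exists (cusp zeta r.+1 theta eps).
by apply: cusp_domain_of_attraction => //; exact: ltnW.
Qed.
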